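(* For integers $n$ and $k$ with $1\leq k\leq n-1$, let $g(n,k)$ be the maximum integer such that every connected graph $G$ of order $n$ with $|E(G)|\leq g(n,k)$ satisfies $rd(G)\leq k$. Then $g(n,k)=n+k-2$.
   Context: All graphs are simple, finite and undirected. For a nontrivial connected graph $G$ with an edge-coloring (adjacent edges may receive the same color), an edge-cut $R$ (a set of edges whose removal disconnects $G$) is a rainbow cut if no two edges of $R$ have the same color; it separates vertices $u,v$ if $u$ and $v$ lie in different components of $G-R$. The coloring is a rainbow disconnection coloring if for every two distinct vertices $u,v$ there is a rainbow cut separating them. The rainbow disconnection number $rd(G)$ is the smallest number of colors in a rainbow disconnection coloring of $G$.
   Formalization: For k = n-1 every connected graph of order n has rd(G) ≤ n-1, so no maximum integer g(n,n-1) exists; existence of the maximum and its value n+k-2 are proved for 1 ≤ k ≤ n-2, and for k = n-1 only that any such maximum would equal n+k-2. *)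

(* Defs.v *)
From mathcomp Require Import all_boot all_order all_algebra.

Set Implicit Arguments.
Unset Strict Implicit.
Unset Printing Implicit Defensive.

Record sgraph := SGraph {
  vertex :> finType;
  adj : rel vertex;
  adj_sym : symmetric adj;
  adj_irrefl : irreflexive adj }.

Section RainbowDisconnection.
Variable G : sgraph.

(* Edges are the unordered pairs {x, y} of adjacent vertices. *)
Definition edges : {set {set G}} :=
  [set [set p.1; p.2] | p in [pred p : G * G | adj p.1 p.2]].

Definition connected_rel (e : rel G) : bool := [forall x, forall y, connect e x y].

Definition connected : bool := connected_rel (@adj G).

(* The adjacency relation of G - R. *)
Definition del_edges (R : {set {set G}}) : rel G :=
  [rel x y | adj x y && ([set x; y] \notin R)].

Definition edge_cut (R : {set {set G}}) : bool :=
  (R \subset edges) && ~~ connected_rel (del_edges R).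

Definition separates (R : {set {set G}}) (u v : G) : bool :=
  ~~ connect (del_edges R) u v.

(* An edge-coloring with k available colors is represented by a function on
   all sets of vertices, of which only the values on edges matter. *)
Section Coloring.
Variables (k : nat) (c : {ffun {set G} -> 'I_k}).

Definition rainbow_cut (R : {set {set G}}) : bool :=
  edge_cut R && [forall a in R, forall b in R, (c a == c b) ==> (a == b)].

Definition rd_coloring : bool :=
  [forall u, forall v, (u != v) ==> [exists R, rainbow_cut R && separates R u v]].

End Coloring.

Definition rd_colorable (k : nat) : bool :=
  [exists c : {ffun {set G} -> 'I_k}, rd_coloring c].

Lemma ex_rd_colorable : exists k, rd_colorable k.
Proof.
exists #|{: {set G}}|; apply/existsP; exists [ffun A => enum_rank A].
apply/forallP => u; apply/forallP => v; apply/implyP => neq_uv.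
have sep : separates edges u v.
  apply/negP => /connectP [[|x p] /=].
    by move=> _ eq_vu; rewrite eq_vu eqxx in neq_uv.
  case/andP => /andP [ux /negP nin] _ _; apply: nin.
  by apply/imsetP; exists (u, x).
apply/existsP; exists edges; rewrite sep andbT /rainbow_cut /edge_cut subxx /=.
apply/andP; split.
  by apply/negP => /forallP /(_ u) /forallP /(_ v); apply/negP.
apply/forall_inP => a _; apply/forall_inP => b _; apply/implyP.
by rewrite !ffunE => /eqP /enum_rank_inj ->.
Qed.

Definition rd : nat := ex_minn ex_rd_colorable.

End RainbowDisconnection.

Import Order.TTheory GRing.Theory Num.Theory.
Local Open Scope ring_scope.

Definition size_forces_rd (n k : nat) (m : int) : Prop :=
  forall G : sgraph, connected G -> #|G| = n ->
    (#|edges G|%:Z <= m) -> (rd G <= k)%N.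

(* m = g(n, k): the largest integer m such that every connected graph of
   order n with at most m edges has rainbow disconnection number at most k.
   For k = n - 1 there is no such m, since rd(G) <= n - 1 for every connected
   graph G of order n; hence g is a relation and not a function. *)
Definition is_g (n k : nat) (m : int) : Prop :=
  size_forces_rd n k m /\ forall m' : int, size_forces_rd n k m' -> m' <= m.

(* Main.v *)
Require Import Defs.
From mathcomp Require Import all_boot all_order all_algebra.
From mathcomp Require Import zify.
Import Order.TTheory GRing.Theory Num.Theory.
Local Open Scope ring_scope.

(** Upper bound: in a connected graph, give the edges of a spanning tree one
    colour and every other edge a colour of its own.  This takes
    [|E| - n + 2] colours, and the non-tree edges together with a single tree
    edge always form a rainbow set, so any two vertices are separated.
    Sharpness: joining [0] to every other vertex and [1] to [2, .., k + 1]
    gives [n + k - 1] edges and [k + 1] edge-disjoint paths from [0] to [1].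
    For [k = n - 1] no maximum exists, because [rd G <= n - 1]: colour [xy] by
    [x + y] modulo [n - 1] and [x oo] by [2 x], where [oo] is one fixed vertex;
    then the star of every vertex other than [oo] is rainbow. *)

Local Open Scope nat_scope.

(** * Edges, and colorings checked through vertex sets *)

Lemma edgesP (G : sgraph) (A : {set G}) :
  reflect (exists x y, adj x y /\ A = [set x; y]) (A \in edges G).
Proof.
apply: (iffP imsetP) => [[[x y] /= xy ->]|[x [y [xy ->]]]]; first by exists x, y.
by exists (x, y).
Qed.

Lemma adj_edges (G : sgraph) (x y : G) : adj x y -> [set x; y] \in edges G.
Proof. by move=> xy; apply/edgesP; exists x, y. Qed.

Lemma rd_le (G : sgraph) k : rd_colorable G k -> rd G <= k.
Proof. by rewrite /rd; case: ex_minnP => m _ min /min. Qed.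

Lemma rd_colorable_rd (G : sgraph) : rd_colorable G (rd G).
Proof. by rewrite /rd; case: ex_minnP. Qed.

(** No edge outside [R] leaves [S], so [S] is a union of components of the graph without [R], and
    [R] separates [u] from [v]. *)
Lemma rd_colorable_by_cuts (G : sgraph) k (c : {set G} -> 'I_k) :
  (forall u v : G, u != v -> exists (R : {set {set G}}) (S : {set G}),
     [/\ R \subset edges G, {in R &, injective c},
         forall x y, adj x y -> [set x; y] \notin R -> (x \in S) = (y \in S)
       & (u \in S) != (v \in S)]) ->
  rd_colorable G k.
Proof.
move=> H; apply/existsP; exists [ffun A => c A].
apply/forallP=> u; apply/forallP=> v; apply/implyP=> /H [R [S [sR inj cl nuv]]].
have sep : separates R u v.
  apply: contra nuv => conn.
  apply/eqP; apply: (closed_connect _ conn) => x y /andP[].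
  exact: cl.
apply/existsP; exists R; rewrite sep andbT /rainbow_cut /edge_cut sR /=.
apply/andP; split.
  by apply: contra sep => /forallP/(_ u)/forallP/(_ v).
apply/forall_inP=> a Ra; apply/forall_inP=> b Rb; apply/implyP.
by rewrite !ffunE => /eqP /inj ->.
Qed.

(** * The bound by the order minus one *)

Lemma rd_lt_order (G : sgraph) : 1 < #|G| -> rd G <= #|G|.-1.
Proof.
case En: #|G| => [|[|m]] // _ /=; apply: rd_le.
pose r (x : G) : nat := enum_rank x.
have r_inj (x y : G) : r x = r y -> x = y by move/val_inj/enum_rank_inj.
have r_lt x : r x < m.+2 by rewrite -En ltn_ord.
have lt_last : m.+1 < #|G| by rewrite En.
pose oo := enum_val (Ordinal lt_last).
have roo : r oo = m.+1 by rewrite /r enum_valK.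
have r_lt' x : x != oo -> r x < m.+1.
  move=> xoo; have := r_lt x; rewrite ltnS leq_eqVlt => /predU1P[E|//].
  by case/eqP: xoo; apply: r_inj; rewrite roo.
(* On an edge avoiding [oo] this is [r x + r y]; on the edge from [x] to [oo] it is [2 * r x]. *)
pose s (A : {set G}) := (\sum_(x in A | x != oo) r x) * (oo \in A).+1.
pose c (A : {set G}) : 'I_m.+1 := inord (s A %% m.+1).
(* Seen from [x], the edge to [oo] acts like an edge to a vertex of rank [r x], a rank no neighbour
   of [x] has. Cancelling [r x] then shows that the star is rainbow. *)
have sE x y : x != oo -> y != x ->
    s [set x; y] = r x + (if y == oo then r x else r y).
  move=> xoo yx; have nxy : x \notin [set y] by rewrite inE eq_sym.
  rewrite /s big_mkcondr big_setU1 //= big_set1 xoo.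
  rewrite !inE [oo == x]eq_sym (negPf xoo) /= [oo == y]eq_sym.
  by case: eqP => _ /=; lia.
have starI x : x != oo ->
    {in [set A in edges G | x \in A] &, injective c}.
  move=> xoo A B.
  have starP C : C \in [set A in edges G | x \in A] ->
      exists2 y, y != x & C = [set x; y].
    rewrite inE => /andP[/edgesP[a [b [ab ->]]]].
    have nab : a != b by apply: contraTneq ab => ->; rewrite adj_irrefl.
    rewrite !inE => /orP[]/eqP->; last by exists a => //; rewrite setUC.
    by exists b => //; rewrite eq_sym.
  case/starP=> y yx -> /starP[z zx ->] /(congr1 val).
  rewrite /= !inordK ?ltn_pmod // !sE // => /eqP; rewrite eqn_modDl.
  have lt1 t : (if t == oo then r x else r t) < m.+1.
    by case: eqP => [_|/eqP]; apply: r_lt'.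
  rewrite !(modn_small (lt1 _)).
  case: (eqVneq y oo) => [->|yoo]; case: (eqVneq z oo) => [->|zoo] // /eqP /r_inj E.
  - by rewrite E eqxx in zx.
  - by rewrite E eqxx in yx.
  - by rewrite E.
apply: (@rd_colorable_by_cuts _ _ c) => u v nuv.
have [x xoo Sx] : exists2 x, x != oo & (u \in [set x]) != (v \in [set x]).
  have [uoo|uoo] := eqVneq u oo.
    exists v; first by rewrite -uoo eq_sym.
    by rewrite !inE eqxx (negPf nuv).
  by exists u => //; rewrite !inE eqxx [v == u]eq_sym (negPf nuv).
exists [set A in edges G | x \in A], [set x]; split=> //.
- by apply/subsetP=> A; rewrite inE => /andP[].
- exact: starI.
move=> a b ab; rewrite in_set adj_edges //= !inE negb_or ![x == _]eq_sym.
by case/andP=> /negPf-> /negPf->.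
Qed.

(** * Spanning trees and the upper bound *)

(** A spanning tree rooted at [r], encoded by parents [p]; the proof takes for [d] the distance from
    [r]. *)
Lemma connected_parent (G : sgraph) (r : G) : connected G ->
  exists (p : G -> G) (d : G -> nat),
    [/\ p r = r, d r = 0 & forall x, x != r -> adj x (p x) /\ d (p x) < d x].
Proof.
move=> cG.
have ex_d x : exists m, [exists t : m.-tuple G, path (@adj G) r t && (last r t == x)].
  have /connectP[q pq ->] : connect (@adj G) r x by move/forallP/(_ r)/forallP: cG.
  by exists (size q); apply/existsP; exists (in_tuple q); rewrite pq eqxx.
pose d x := ex_minn (ex_d x).
have d_le q : path (@adj G) r q -> d (last r q) <= size q.
  move=> pq; rewrite /d; case: ex_minnP => m _; apply.
  by apply/existsP; exists (in_tuple q); rewrite pq eqxx.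
have ex_p x : x != r -> exists y, adj x y && (d y < d x).
  move=> xr; have : exists2 q, path (@adj G) r q /\ last r q = x & size q = d x.
    rewrite /d; case: ex_minnP => m /existsP[t /andP[pt /eqP tx]] _.
    by exists t; rewrite ?size_tuple.
  case=> q [pq lx] Es; case/lastP: q pq lx Es => [_ /= E|q z].
    by rewrite E eqxx in xr.
  rewrite rcons_path last_rcons size_rcons => /andP[pq az] zx <-; rewrite zx in az.
  by exists (last r q); rewrite adj_sym az /= ltnS d_le.
pose p x := if x == r then r else odflt x [pick y | adj x y && (d y < d x)].
exists p, d; split=> [||x xr]; first by rewrite /p eqxx.
  by apply/eqP; rewrite -leqn0; apply: (d_le [::]).
rewrite /p (negPf xr); case: pickP => [y /andP[] //|none].
by have [y] := ex_p x xr; rewrite none.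
Qed.

Lemma rd_le_cyclomatic (G : sgraph) k : 0 < k -> connected G ->
  #|edges G| + 2 <= #|G| + k -> rd G <= k.
Proof.
case: k => // k _ cG leE; apply: rd_le.
have [r _|G0] := pickP (@predT G); last first.
  apply: (@rd_colorable_by_cuts _ _ (fun _ => ord0)) => u.
  by have := G0 u.
have [p [d [pr dr pP]]] := connected_parent G r cG.
pose e x := [set x; p x].
(* If [e x = e y] with [x] and [y] distinct, each is the parent of the other, and [d] decreases both
   ways. *)
have e_inj : {in [set~ r] &, injective e}.
  move=> x y; rewrite !inE => xr yr E.
  have [_ dx] := pP x xr; have [_ dy] := pP y yr.
  have : x \in e y by rewrite -E set21.
  have : y \in e x by rewrite E set21.
  rewrite !inE => /orP[/eqP-> //|/eqP Ey] /orP[/eqP//|/eqP Ex].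
  by move: dx dy; rewrite -Ex -Ey; lia.
pose F := e @: [set~ r].
have FE : F \subset edges G.
  apply/subsetP=> A /imsetP[x]; rewrite !inE => xr ->.
  by apply: adj_edges; have [] := pP x xr.
pose N := edges G :\: F.
(* The tree has [#|G| - 1] edges. Of the [k.+1] colours, [ord0] serves the tree and the other [k]
   suffice for [N]. *)
have leN : #|N| <= k.
  have := cardsID F (edges G); rewrite (setIidPr FE) -/N card_in_imset // cardsC1.
  have : 0 < #|G| by apply/card_gt0P; exists r.
  by move: leE; set a := #|N|; set b := #|edges G|; lia.
pose c (A : {set G}) : 'I_k.+1 :=
  if A \in F then ord0 else inord (index A (enum N)).+1.
have cN A : A \in N -> val (c A) = (index A (enum N)).+1.
  move=> AN; rewrite /c; move: (AN); rewrite inE => /andP[/negPf-> _].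
  rewrite /= inordK // ltnS (leq_trans _ leN) //.
  by rewrite cardE index_mem mem_enum.
(* [fconnect p x w] means that [w] is [x] or one of its ancestors. *)
have anc_d x w : fconnect p x w -> x = w \/ d w < d x.
  move/iter_findex <-; elim: (findex p x w) => [|i] /=; first by left.
  set y := iter i p x => IH.
  have [Ey|yr] := eqVneq y r; first by rewrite Ey pr -Ey.
  by right; have [_] := pP y yr; case: IH => [<-|]; lia.
apply: (@rd_colorable_by_cuts _ _ c) => u v nuv.
(* For [w] take the deeper of [u] and [v]: the other one lies outside the subtree below [w]. *)
have [w wr Sw] : exists2 w, w != r &
    (u \in [set x | fconnect p x w]) != (v \in [set x | fconnect p x w]).
  have sub_anc a b : a != b -> d b <= d a -> a != r /\ ~~ fconnect p b a.
    move=> nab dba; split.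
      apply: contraNneq nab => Ea; rewrite Ea dr in dba *; rewrite eq_sym.
      by apply: contraLR dba => /pP[_]; lia.
    by apply/negP=> /anc_d[E|]; [rewrite E eqxx in nab | lia].
  have [duv|dvu] := leqP (d u) (d v).
    have [vr nc] : v != r /\ ~~ fconnect p u v by apply: sub_anc; rewrite 1?eq_sym.
    by exists v => //; rewrite !inE connect0 (negPf nc).
  have [ur nc] := sub_anc u v nuv (ltnW dvu).
  by exists u => //; rewrite !inE connect0 (negPf nc).
exists (e w |: N), [set x | fconnect p x w]; split=> //.
- rewrite subUset subsetDl andbT sub1set (subsetP FE) //.
  by rewrite imset_f // !inE.
- have ewF : e w \in F by rewrite imset_f // !inE.
  have cw : val (c (e w)) = 0 by rewrite /c ewF.
  move=> A B /setU1P[->|AN] /setU1P[->|BN] //; move/(congr1 val).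
  + by rewrite cw cN.
  + by rewrite cw cN.
  + rewrite !cN // => -[] E.
    by rewrite -[A](nth_index set0 (s := enum N)) ?mem_enum // E nth_index ?mem_enum.
(* Only the tree edge [e w] leaves the subtree below [w]: from any [x] other than [w], the way up to
   [w] passes through [p x]. *)
have step x : x != r -> e x != e w ->
    (x \in [set z | fconnect p z w]) = (p x \in [set z | fconnect p z w]).
  move=> xr nxw; rewrite !inE; apply/idP/idP; last first.
    by apply: connect_trans; apply: connect1; rewrite /= eqxx.
  have nEx : x != w by apply: contraNneq nxw => ->.
  move/iter_findex; case: (findex p x w) => [E|i <-].
    by rewrite -E eqxx in nEx.
  by rewrite iterSr fconnect_iter.
move=> x y xy; rewrite !inE negb_or adj_edges // andbT negbK => /andP[nw].
case/imsetP=> z; rewrite !inE => zr E; rewrite E in nw.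
have := step z zr nw; rewrite !inE => Ez.
have : x \in e z by rewrite -E set21.
have : y \in e z by rewrite -E set22.
by rewrite !inE => /orP[]/eqP-> /orP[]/eqP->.
Qed.

(** * The extremal graph *)

Section Extremal.

Variables (m k : nat).

Definition fan_rel : rel 'I_m.+2 :=
  [rel x y : 'I_m.+2 | (x < y) && ((x == 0 :> nat) || (x == 1 :> nat) && (y < k.+2))].

Definition fan_adj : rel 'I_m.+2 := [rel x y | fan_rel x y || fan_rel y x].

Lemma fan_sym : symmetric fan_adj.
Proof. move=> x y; exact: orbC. Qed.

Lemma fan_irrefl : irreflexive fan_adj.
Proof. by move=> x; rewrite /fan_adj /= /fan_rel /= ltnn. Qed.

Definition fan := SGraph fan_sym fan_irrefl.

Let v0 : fan := @Ordinal m.+2 0 isT.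
Let v1 : fan := @Ordinal m.+2 1 isT.

Lemma fan_connected : connected fan.
Proof.
have c0 x : connect (@adj fan) v0 x.
  have [->|x0] := eqVneq x v0; first exact: connect0.
  apply: connect1; rewrite /adj /= /fan_adj /= /fan_rel /= andbT.
  by rewrite lt0n -[0]/(val v0) (inj_eq val_inj) x0.
have sym : connect_sym (@adj fan) by apply: sym_connect_sym; apply: fan_sym.
apply/forallP=> x; apply/forallP=> y; apply: connect_trans (c0 y).
by rewrite sym.
Qed.

(** Every edge is in the image of [f], which lists [m.+1] pairs at [0] and [k] more at [1]. *)
Lemma card_fan_edges : #|edges fan| <= m.+1 + k.
Proof.
pose f (z : 'I_m.+1 + 'I_k) : {set fan} :=
  match z with
  | inl i => [set v0; inord i.+1]
  | inr i => [set v1; inord i.+2]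
  end.
have sub : edges fan \subset f @: setT.
  have aux (x y : fan) : fan_rel x y -> [set x; y] \in f @: setT.
    case/andP=> ltxy /orP[/eqP x0|/andP[/eqP x1 ltyk]].
      have lty : y.-1 < m.+1 by have := ltn_ord y; lia.
      apply/imsetP; exists (inl (Ordinal lty)) => //=; congr [set _; _].
        exact: val_inj.
      have Ey : y.-1.+1 = y by lia.
      by rewrite Ey; apply/esym/inord_val.
    have lty : y.-2 < k by lia.
    apply/imsetP; exists (inr (Ordinal lty)) => //=; congr [set _; _].
      exact: val_inj.
    have Ey : y.-2.+2 = y by lia.
    by rewrite Ey; apply/esym/inord_val.
  apply/subsetP=> A /edgesP[x [y [/orP[xy|yx] ->]]]; first exact: aux.
  by rewrite setUC; apply: aux.
apply: leq_trans (subset_leq_card sub) _; apply: leq_trans (leq_imset_card _ _) _.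
by rewrite cardsT card_sum !card_ord.
Qed.

(* A cut between [0] and [1] meets each of the [k + 1] edge-disjoint paths
   [0 - 1] and [0 - i - 1]; [g] picks one edge of the cut on each path. *)
Lemma rd_fan : k <= m -> k < rd fan.
Proof.
move=> lekm.
have /existsP[c /forallP/(_ v0)/forallP/(_ v1)/= H] := rd_colorable_rd fan.
case/existsP: H => R /andP[/andP[_ rainbow] sep].
have inR (x y : fan) : adj x y -> ~~ connect (@del_edges fan R) x y -> [set x; y] \in R.
  by move=> xy; apply: contraR => nR; apply: connect1; apply/andP.
pose w (i : 'I_k) : fan := inord i.+2.
have wE i : val (w i) = i.+2 by rewrite /= inordK // !ltnS (leq_trans _ lekm).
pose g (z : option 'I_k) : {set fan} :=
  if z is Some i then
    if [set v0; w i] \in R then [set v0; w i] else [set w i; v1]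
  else [set v0; v1].
have gR z : g z \in R.
  case: z => [i|] /=; last by apply: inR.
  case: ifPn => // nR; apply: inR.
    by rewrite /adj /= /fan_adj /= /fan_rel /= !wE /= !ltnS ltn_ord.
  (* The edge from [v0] to [w i] survives, so a connection from [w i] to [v1] would join [v0] to
     [v1]. *)
  apply: contra sep; apply: connect_trans; apply: connect1.
  by apply/andP; split=> //; rewrite /adj /= /fan_adj /= /fan_rel /= !wE.
(* The middle vertex [w i] lies on [g (Some i)] and on no other chosen edge, which makes [g]
   injective. *)
have wg i : w i \in g (Some i) by rewrite /=; case: ifP; rewrite ?set21 ?set22.
have v0w i : (v0 == w i) = false by rewrite -val_eqE wE.
have v1w i : (v1 == w i) = false by rewrite -val_eqE wE.
have wg' z i : w i \in g z -> z = Some i.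
  case: z => [j|] /=; last by rewrite !inE ![w i == _]eq_sym v0w v1w.
  have E : w i == w j -> Some j = Some i.
    by move/eqP/(congr1 val); rewrite !wE => -[] /val_inj->.
  by case: ifP => _; rewrite !inE ![w i == _]eq_sym ?v0w ?v1w ?orbF /= eq_sym.
have g_inj : injective g.
  case=> [i|] z Eg; first by rewrite (wg' z i) // -Eg.
  by case: z Eg => [i|] // Eg; apply: wg'; rewrite Eg.
have cg_inj : injective (c \o g).
  move=> a b /= Ec; apply: g_inj; apply/eqP.
  move/forall_inP/(_ _ (gR a))/forall_inP/(_ _ (gR b))/implyP: rainbow; apply.
  exact/eqP.
by have := leq_card _ cg_inj; rewrite card_option !card_ord.
Qed.

End Extremal.

(** * The value of g(n, k) *)

Local Open Scope ring_scope.

Theorem theorem3p3 (n k : nat) (hk : (1 <= k <= n - 1)%N) :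
  (forall g : int, is_g n k g -> g = n%:Z + k%:Z - 2%:Z) /\
  ((k <= n - 2)%N -> is_g n k (n%:Z + k%:Z - 2%:Z)).
Proof.
have [k_gt0 le_kn] := andP hk.
have is_g_nk : (k <= n - 2)%N -> is_g n k (n%:Z + k%:Z - 2%:Z).
  move=> le_kn2; split=> [G cG nG leE | m' forces].
    by apply: rd_le_cyclomatic => //; rewrite nG; lia.
  rewrite leNgt; apply/negP => lt_m'.
  have le_k : (k <= n.-2)%N by lia.
  (* As [m'] is at least [n + k - 1], the fan of order [n] meets the edge bound. *)
  have /negP[] : ~~ (rd (fan n.-2 k) <= k)%N by rewrite -ltnNge rd_fan.
  apply: forces; first exact: fan_connected.
    by rewrite card_ord; lia.
  by have := card_fan_edges n.-2 k; lia.
split=> // g [forces max_g].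
have [le_kn2|lt_kn2] := leqP k (n - 2).
  have [forces' max'] := is_g_nk le_kn2.
  by apply/eqP; rewrite eq_le max' //= max_g.
(* Here [k = n - 1], so [rd] is at most [k] for every connected graph of order [n], and [g + 1]
   contradicts the maximality of [g]. *)
have /max_g : size_forces_rd n k (g + 1); last by lia.
move=> G _ nG _; apply: leq_trans (rd_lt_order G _) _; rewrite nG; lia.
Qed.
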